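(* Let $H$ be a graph containing a cycle $C$ and two adjacent vertices neither of which has a neighbor in $V(C)$. Then the class of $H$-subdivisions does not have the induced Erdős–Pósa property.
   Context: All graphs are finite and simple. A subdivision of $H$ is a graph obtained from $H$ by repeatedly replacing an edge by a path of length $2$ through a new vertex. An induced subdivision of $H$ in $G$ is an induced subgraph of $G$ isomorphic to a subdivision of $H$. The class of $H$-subdivisions has the induced Erdős–Pósa property if there is a function $f:\mathbb N\to\mathbb R$ such that for every graph $G$ and every positive integer $k$, $G$ contains either $k$ pairwise vertex-disjoint induced subdivisions of $H$ or a set of at most $f(k)$ vertices meeting every induced subdivision of $H$. *)

(* Defs.v *)
From mathcomp Require Import all_boot.
Set Implicit Arguments. Unset Strict Implicit. Unset Printing Implicit Defensive.

Record sgraph := SGraph {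
  vert :> finType;
  adj : rel vert;
  adj_sym : symmetric adj;
  adj_irr : irreflexive adj }.

Definition giso (T1 T2 : finType) (e1 : rel T1) (e2 : rel T2) : Prop :=
  exists f : T1 -> T2, bijective f /\ forall x y, e2 (f x) (f y) = e1 x y.

(* (T2,e2) is obtained from (T1,e1) by replacing the edge uv by a path
   u - w - v through a new vertex w: f embeds the old vertices onto all
   vertices other than w. *)
Definition subdiv_step (T1 T2 : finType) (e1 : rel T1) (e2 : rel T2) : Prop :=
  exists (u v : T1), e1 u v /\
  exists (w : T2) (f : T1 -> T2),
    injective f /\
    (forall z, (z \in codom f) = (z != w)) /\
    (forall x y, e2 (f x) (f y) =
       e1 x y && ~~ (((x == u) && (y == v)) || ((x == v) && (y == u)))) /\
    (forall x, e2 w (f x) = (x == u) || (x == v)) /\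
    (forall x, e2 (f x) w = (x == u) || (x == v)) /\
    ~~ e2 w w.

Inductive subdivision (T1 : finType) (e1 : rel T1) : forall T2 : finType, rel T2 -> Prop :=
| subdiv_iso (T2 : finType) (e2 : rel T2) : giso e1 e2 -> subdivision e1 e2
| subdiv_more (T2 T3 : finType) (e2 : rel T2) (e3 : rel T3) :
    subdivision e1 e2 -> subdiv_step e2 e3 -> subdivision e1 e3.

Definition induced_rel (G : sgraph) (X : {set G}) : rel {x : G | x \in X} :=
  fun x y => adj (val x) (val y).

Definition induced_subdiv (H G : sgraph) (X : {set G}) : Prop :=
  subdivision (@adj H) (@induced_rel G X).

Definition induced_EP (H : sgraph) : Prop :=
  exists f : nat -> nat, forall (G : sgraph) (k : nat), 0 < k ->
    (exists Xs : 'I_k -> {set G},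
        (forall i, induced_subdiv H (Xs i)) /\
        (forall i j, i != j -> [disjoint Xs i & Xs j]))
    \/
    (exists Y : {set G}, #|Y| <= f k /\
        forall X : {set G}, induced_subdiv H X -> ~~ [disjoint Y & X]).

Definition is_cycle (H : sgraph) (c : seq H) : Prop :=
  [/\ 3 <= size c, uniq c & cycle (@adj H) c].

(* Main.v *)
Require Import Defs.
From mathcomp Require Import all_boot.
From mathcomp Require Import zify.

(** Take many long subdivisions of [H], the copies, such that for every edge [e] of [H] any
    two copies cross in one vertex on their paths replacing [e], each vertex lies on at most
    two copies, and non-crossing vertices of different copies are all adjacent. A few
    vertices cannot hit all copies. Conversely, a subdivision of [H] contains a nonempty set
    [Z] of minimum degree two (from the cycle) and an edge anticomplete to it. The crossing
    vertices are independent, so that edge has a private vertex of some copy [i], which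
    confines [Z] to copy [i]; as [Z] has minimum degree two, it contains the whole path of
    some edge [e] in copy [i]. Among more than [|H|^2] induced subdivisions, two get the same
    [e], and hence meet. *)

Set Implicit Arguments. Unset Strict Implicit. Unset Printing Implicit Defensive.

(** * Subdivisions up to isomorphism *)

Lemma giso_trans (T1 T2 T3 : finType) (e1 : rel T1) (e2 : rel T2) (e3 : rel T3) :
  giso e1 e2 -> giso e2 e3 -> giso e1 e3.
Proof.
move=> [f [bf hf]] [g [bg hg]]; exists (g \o f); split; first exact: bij_comp.
by move=> x y /=; rewrite hg hf.
Qed.

Lemma subdiv_step_giso (T1 T2 T3 : finType) (e1 : rel T1) (e2 : rel T2) (e3 : rel T3) :
  subdiv_step e1 e2 -> giso e2 e3 -> subdiv_step e1 e3.
Proof.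
move=> [u [v [euv [w [f [fI [fC [ff [wf [fw ww]]]]]]]]]] [g [bg hg]].
exists u, v; split=> //; exists (g w), (g \o f).
have gI := bij_inj bg.
split; first exact: inj_comp.
split; last by (do !split) => *; rewrite /= hg.
have [h gK hK] := bg.
move=> z; rewrite -[z]hK (inj_eq gI) -fC.
apply/codomP/codomP => [[x /gI ->]|[x ->]]; by exists x.
Qed.

Lemma subdivision_giso (T1 T2 T3 : finType) (e1 : rel T1) (e2 : rel T2) (e3 : rel T3) :
  subdivision e1 e2 -> giso e2 e3 -> subdivision e1 e3.
Proof.
case=> [S e h1 h2 | S S' e e' h s h2]; first exact/subdiv_iso/(giso_trans h1).
exact: subdiv_more h (subdiv_step_giso s h2).
Qed.

Lemma giso_induced (T : finType) (e : rel T) (G : sgraph) (F : T -> G) :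
  injective F -> (forall x y, adj (F x) (F y) = e x y) ->
  giso e (@induced_rel G (F @: T)).
Proof.
move=> FI Fe.
pose g x : {y : G | y \in F @: T} := exist _ (F x) (imset_f F (erefl : x \in T)).
exists g; split=> //.
have gI : injective g by move=> x y /(congr1 val) /FI.
apply: inj_card_bij => //.
by rewrite card_sig -(card_imset _ FI).
Qed.

(** * A core with an anticomplete edge, preserved under subdivision *)

(** Minimum degree two in [Z] replaces the cycle: it is checked vertex by vertex, so subdividing
    needs no cyclic order. *)
Definition core_and_edge (T : finType) (e : rel T) (Z : {set T}) (a b : T) : Prop :=
  [/\ exists z, z \in Z,
      forall z, z \in Z -> exists x y, [/\ x \in Z, y \in Z, x != y, e z x & e z y],
      a \notin Z, b \notin Z & e a b] /\
  forall z, z \in Z -> ~~ e a z && ~~ e b z.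

Definition has_core_and_edge (T : finType) (e : rel T) : Prop :=
  [/\ symmetric e, irreflexive e & exists Z a b, core_and_edge e Z a b].

Lemma core_and_edge_giso (T1 T2 : finType) (e1 : rel T1) (e2 : rel T2) :
  giso e1 e2 -> has_core_and_edge e1 -> has_core_and_edge e2.
Proof.
move=> [f [bf hf]] [sym irr [Z [a [b [[[z0 Z0] Zd aZ bZ eab] anti]]]]].
have fI := bij_inj bf; have [g fK gK] := bf.
split.
- by move=> x y; rewrite -[x]gK -[y]gK !hf.
- by move=> x; rewrite -[x]gK hf.
exists (f @: Z), (f a), (f b); split; first split.
- by exists (f z0); apply: imset_f.
- move=> _ /imsetP[z zZ ->]; have [x [y [xZ yZ xy ex ey]]] := Zd z zZ.
  by exists (f x), (f y); rewrite !hf !imset_f // (inj_eq fI).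
- by rewrite mem_imset.
- by rewrite mem_imset.
- by rewrite hf.
by move=> _ /imsetP[z zZ ->]; rewrite !hf anti.
Qed.

(** The new vertex joins the core if the subdivided edge lies inside it, and replaces [b] if that
    edge is [ab]. *)
Lemma core_and_edge_step (T1 T2 : finType) (e1 : rel T1) (e2 : rel T2) :
  subdiv_step e1 e2 -> has_core_and_edge e1 -> has_core_and_edge e2.
Proof.
move=> [u [v [euv [w [f [fI [fC [ff [wf [fw ww]]]]]]]]]].
move=> [sym irr [Z [a [b [[[z0 Z0] Zd aZ bZ eab] anti]]]]].
have uv : u != v by apply: contraTneq euv => ->; rewrite irr.
have fnw x : f x != w by rewrite -fC codom_f.
have caseT z : (z = w) \/ exists x, z = f x.
  have [->|nz] := eqVneq z w; first by left.
  by right; apply/codomP; rewrite fC.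
split.
- move=> x y; case: (caseT x) => [->|[x' ->]]; case: (caseT y) => [->|[y' ->]] //.
  + by rewrite wf fw.
  + by rewrite wf fw.
  + by rewrite !ff sym orbC ![(y' == _) && _]andbC.
- move=> x; case: (caseT x) => [->|[x' ->]]; first exact/negbTE.
  by rewrite ff irr.
pose Z' := f @: Z :|: [set y | (y == w) && (u \in Z) && (v \in Z)].
have fZ x : (f x \in Z') = (x \in Z).
  by rewrite !inE (negbTE (fnw x)) orbF mem_imset.
have wZ : (w \in Z') = (u \in Z) && (v \in Z).
  rewrite !inE eqxx /=; case: imsetP => // -[x _ wx].
  by have := fnw x; rewrite -wx eqxx.
pose isuv x y := ((x == u) && (y == v)) || ((x == v) && (y == u)).
have core : forall z, z \in Z' ->
    exists x y, [/\ x \in Z', y \in Z', x != y, e2 z x & e2 z y].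
  move=> z; case: (caseT z) => [->|[x ->]].
    rewrite wZ => /andP[uZ vZ]; exists (f u), (f v).
    by rewrite !fZ !wf !eqxx orbT (inj_eq fI).
  rewrite fZ => xZ; have [y1 [y2 [y1Z y2Z y12 ey1 ey2]]] := Zd x xZ.
  (* Neighbours in [Z] carry over, except that across the subdivided edge the neighbour becomes
     [w]. *)
  pose phi y := if isuv x y then w else f y.
  have phiP y : y \in Z -> e1 x y -> phi y \in Z' /\ e2 (f x) (phi y).
    move=> yZ exy; rewrite /phi; case: ifP => [|nuv].
      rewrite wZ fw; case/orP=> /andP[/eqP<- /eqP<-]; by rewrite xZ yZ eqxx ?orbT.
    by rewrite fZ ff exy /=; split=> //; rewrite -/(isuv _ _) nuv.
  have [p1 p1'] := phiP y1 y1Z ey1; have [p2 p2'] := phiP y2 y2Z ey2.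
  exists (phi y1), (phi y2); split=> //.
  rewrite /phi; case: ifP => h1; case: ifP => h2; rewrite ?fnw ?(inj_eq fI) //.
    case/eqP: y12; move/eqP: uv => uv.
    by case/orP: h1 => /andP[/eqP ? /eqP ?]; case/orP: h2 => /andP[/eqP ? /eqP ?]; congruence.
  by rewrite eq_sym fnw.
have ex0 : exists z, z \in Z' by exists (f z0); rewrite fZ.
have antif x : x \in Z -> ~~ e2 (f a) (f x) && ~~ e2 (f b) (f x).
  by move=> xZ; rewrite !ff; case/andP: (anti x xZ) => /negbTE-> /negbTE->.
(* If [ab] is subdivided, the edge from [f a] to [w] serves: the only neighbours of [w] are the
   images of [a] and [b], both outside the core. *)
case ab : (isuv a b).
  have wnZ : w \notin Z'.
    rewrite wZ; move: ab aZ; rewrite /isuv.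
    by case/orP=> /andP[/eqP-> _] /negbTE->; rewrite ?andbF.
  exists Z', (f a), w; split; first split=> //.
  - by rewrite fZ.
  - by rewrite fw; case/orP: ab => /andP[-> _]; rewrite ?orbT.
  move=> z zZ; case: (caseT z) zZ => [->|[x ->]]; first by rewrite (negbTE wnZ).
  rewrite fZ => xZ; case/andP: (antif x xZ) => -> _ /=; rewrite wf.
  apply: contraL xZ.
  by case/orP: ab => /andP[/eqP<- /eqP<-] /orP[] /eqP->.
exists Z', (f a), (f b); split; first split=> //.
- by rewrite fZ.
- by rewrite fZ.
- by rewrite ff eab -/(isuv _ _) ab.
move=> z zZ; case: (caseT z) zZ => [->|[x ->]]; last by rewrite fZ => /antif.
rewrite wZ !fw => /andP[uZ vZ].
have nZ c : c \notin Z -> ~~ ((c == u) || (c == v)).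
  by apply: contra => /orP[] /eqP->.
by rewrite !nZ.
Qed.

Lemma core_and_edge_subdivision (T1 : finType) (e1 : rel T1) (T2 : finType) (e2 : rel T2) :
  subdivision e1 e2 -> has_core_and_edge e1 -> has_core_and_edge e2.
Proof.
move=> S h1; elim: S => [T e i|T T' e e' _ IH s]; first exact: core_and_edge_giso i h1.
exact: core_and_edge_step s IH.
Qed.

Lemma core_and_edge_cycle (H : sgraph) (c : seq H) (a b : H) :
  is_cycle c -> adj a b -> (forall v, v \in c -> ~~ adj a v && ~~ adj b v) ->
  has_core_and_edge (@adj H).
Proof.
move=> [sc uc cc] ab anti; split; [exact: adj_sym | exact: adj_irr |].
have sym := @adj_sym H.
exists [set x in c], a, b; split; first split=> //.
- by case: c sc {uc cc anti} => // x c _; exists x; rewrite inE mem_head.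
- move=> z; rewrite inE => zc; have [i p rp] := rot_to zc.
  have sp : size (z :: p) = size c by rewrite -rp size_rot.
  have mp x : (x \in c) = (x \in z :: p) by rewrite -rp mem_rot.
  have up : uniq (z :: p) by rewrite -rp rot_uniq.
  have cp : cycle (@adj H) (z :: p) by rewrite -rp rot_cycle.
  case: p sp mp up cp {rp} => [|y p]; first by move=> E; rewrite -E in sc.
  case/lastP: p => [E|p x _ mp]; first by rewrite -E in sc.
  rewrite /= rcons_path /= last_rcons => /and3P[_ yn _] /and3P[zy _ xz].
  exists y, x; rewrite !inE !mp !inE !eqxx !orbT zy sym xz; split=> //.
    by rewrite mem_rcons mem_head !orbT.
  by apply: contraNneq yn => ->; rewrite mem_rcons inE eqxx.
(* If [a] were on the cycle, anticompleteness would forbid the edge [ab]. *)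
- by rewrite inE; apply/negP=> /anti; rewrite [adj b a]sym ab andbF.
- by rewrite inE; apply/negP=> /anti; rewrite ab.
by move=> z; rewrite inE => /anti.
Qed.

(** * Explicit subdivisions with prescribed path lengths *)

Section Paths.
Variables (H : sgraph) (L : nat).

(* Each edge of H is traversed in one direction only. *)
Definition dart (d : H * H) := adj d.1 d.2 && (enum_rank d.1 < enum_rank d.2).

Lemma dart_neq d : dart d -> d.1 != d.2.
Proof. by case/andP=> _; apply: contraTneq => ->; rewrite ltnn. Qed.

Lemma dart_anti x y : dart (x, y) -> dart (y, x) = false.
Proof. by rewrite /dart /= => /andP[_ h]; rewrite ltnNge (ltnW h) andbF. Qed.

Lemma dart_adj x y : dart (x, y) || dart (y, x) = adj x y.
Proof.
rewrite /dart /= [adj y x]adj_sym -andb_orr; case exy: (adj x y) => //=.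
have: x != y by apply: contraTneq exy => ->; rewrite adj_irr.
by rewrite -(inj_eq enum_rank_inj) neq_ltn.
Qed.

Implicit Type l : H * H -> nat.

(* [inr (d, t)] is the inner vertex at distance [t.+1] from [d.1] on the path
   replacing the dart [d]; the path has [l d] inner vertices. *)
Definition path_vertex l (v : H + (H * H) * 'I_L) : bool :=
  if v is inr (d, t) then t < l d else true.

Definition path_rel l (v w : H + (H * H) * 'I_L) : bool :=
  match v, w with
  | inl x, inl y => dart (x, y) && (l (x, y) == 0) || dart (y, x) && (l (y, x) == 0)
  | inl x, inr (d, t) | inr (d, t), inl x =>
      (x == d.1) && (t == 0 :> nat) || (x == d.2) && (t.+1 == l d)
  | inr (d, t), inr (d', t') => (d == d') && ((t.+1 == t') || (t'.+1 == t))
  end.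

(** One ambient type serves all lengths up to [L], so lengthening a path keeps the old vertices in
    place. *)
Definition path_type l : predArgType := {v : H + (H * H) * 'I_L | path_vertex l v}.

Definition path_graph l : rel (path_type l) := fun v w => path_rel l (val v) (val w).

(** The subdivided edge is the last one of the path of [d0], so the new vertex takes the next free
    position [l d0]. *)
Lemma path_graph_step l l' d0 :
  dart d0 -> l' d0 = (l d0).+1 -> (forall d, d != d0 -> l' d = l d) ->
  l d0 < L -> subdiv_step (@path_graph l) (@path_graph l').
Proof.
move=> dd El' El lL.
have d12 := dart_neq dd.
have [w0 w0E] : exists w0 : 'I_L, w0 = l d0 :> nat by exists (Ordinal lL).
have sub v : path_vertex l v -> path_vertex l' v.
  case: v => // -[d t] /=; have [->|nd] := eqVneq d d0; last by rewrite El.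
  by rewrite El' => /ltnW.
(* The vertex just before [d0.2]: the last inner vertex, or [d0.1] on an empty path. The default
   [w0] is never taken, since [n < L]. *)
pose u0 : H + (H * H) * 'I_L :=
  if l d0 is n.+1 then inr (d0, insubd w0 n) else inl d0.1.
have u0P : path_vertex l u0.
  rewrite /u0; case E: (l d0) => [|n] //=; rewrite val_insubd E.
  by case: ifP => //; lia.
pose u : path_type l := Sub u0 u0P.
pose v : path_type l := Sub (inl d0.2) isT.
have wP : path_vertex l' (inr (d0, w0)) by rewrite /= El' w0E.
pose w : path_type l' := Sub (inr (d0, w0)) wP.
pose f (x : path_type l) : path_type l' := Sub (val x) (sub _ (valP x)).
have vf x : val (f x) = val x by [].
have uinl x : (inl x == u0) = (x == d0.1) && (l d0 == 0).
  by rewrite /u0; case: (l d0) => [|n]; rewrite ?andbT ?andbF.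
have uinr d t : (inr (d, t) == u0) = (d == d0) && (t.+1 == l d0).
  rewrite /u0; case E: (l d0) => [|n]; first by rewrite andbF.
  rewrite -[LHS]/((d, t) == (d0, _)) xpair_eqE -val_eqE /= val_insubd eqSS.
  by rewrite ifT //; lia.
have vinl x : (inl x == inl d0.2 :> H + (H * H) * 'I_L) = (x == d0.2) by [].
have vinr p : (inr p == inl d0.2 :> H + (H * H) * 'I_L) = false by [].
exists u, v; split.
  rewrite /path_graph /= /u0; case E: (l d0) => [|n] /=.
    by move: dd E; case: (d0) => x y -> ->.
  by rewrite val_insubd E eqxx ifT ?eqxx ?orbT //; lia.
exists w, f; split; first by move=> x y /(congr1 val) E; apply: val_inj.
split.
  move=> z; apply/codomP/idP => [[x ->]|zw].
    rewrite -val_eqE vf /=; case: x => -[x|[d t]] //= h.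
    by apply/eqP=> E; case: E h => -> ->; rewrite w0E ltnn.
  have zP : path_vertex l (val z).
    move: zw; rewrite -val_eqE /=; case: z => -[x|[d t]] //= h.
    rewrite -[inr _ == _]/((d, t) == (d0, _)) xpair_eqE -val_eqE /=.
    have [Ed|nd] := eqVneq d d0; last by rewrite -El.
    by move: h; rewrite Ed El' /=; lia.
  by exists (Sub (val z) zP); apply: val_inj.
split.
  move=> [[x|[d t]] hx] [[y|[d' t']] hy];
    rewrite /path_graph /= -!val_eqE /= ?uinl ?uinr ?vinl ?vinr.
  - have zE d : (l' d == 0) = (d != d0) && (l d == 0).
      by have [->|nd] := eqVneq d d0; [rewrite El' | rewrite El].
    have pE p q : (p == d0.1) && (q == d0.2) = ((p, q) == d0) by case: (d0).
    have -> : (x == d0.1) && (l d0 == 0) && (y == d0.2) || [&& x == d0.2, y == d0.1 & l d0 == 0]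
        = (l d0 == 0) && (((x, y) == d0) || ((y, x) == d0)).
      rewrite -!pE; case: (x == d0.1); case: (x == d0.2); case: (y == d0.1);
      by case: (y == d0.2); case: (l d0 == 0).
    rewrite !zE.
    have [E|_] := eqVneq (x, y) d0; last first.
      have [E|_] := eqVneq (y, x) d0; last by rewrite andbF andbT.
      rewrite -E in dd *; rewrite dd dart_anti //=.
      by case: (l _ == 0).
    rewrite -E in dd *; rewrite dd dart_anti //=.
    by case: (l _ == 0).
  - rewrite andbF /=; have [E|nd] := eqVneq d' d0; last by rewrite El // andbF andbT.
    move: hy => /=; rewrite E El'; have [->|_] := eqVneq x d0.1.
      by rewrite (negbTE d12) /= orbF andbT.
    by case: (x == d0.2) => //=; lia.
  - rewrite orbF; have [E|nd] := eqVneq d d0; last by rewrite El // andbT.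
    move: hx => /=; rewrite E El'; have [->|_] := eqVneq y d0.1.
      by rewrite (negbTE d12) /= !andbF /= andbT.
    by case: (y == d0.2) => //=; lia.
  - by rewrite !andbF andbT.
split; [|split].
- move=> [[x|[d t]] hx]; rewrite /path_graph /= -!val_eqE /= ?uinl ?uinr ?vinl ?vinr.
    by rewrite w0E El' eqxx andbT.
  rewrite orbF eq_sym; have [E|//] := eqVneq d d0; move: hx; rewrite /= w0E E; lia.
- move=> [[x|[d t]] hx]; rewrite /path_graph /= -!val_eqE /= ?uinl ?uinr ?vinl ?vinr.
    by rewrite w0E El' eqxx andbT.
  rewrite orbF; have [E|//] := eqVneq d d0; move: hx; rewrite /= w0E E; lia.
- by rewrite /path_graph /= eqxx /=; lia.
Qed.

(** Induction on the total number of inner vertices, removing one from a nonempty path; with none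
    left the graph is [H]. *)
Lemma path_graph_subdivision l :
  (forall d, l d <= L) -> (forall d, ~~ dart d -> l d = 0) ->
  subdivision (@adj H) (@path_graph l).
Proof.
move En: (\sum_d l d) => n.
elim: n l En => [|n IH] l En lL ld.
  have l0 d : l d = 0 by apply/eqP; move/eqP: En; rewrite sum_nat_eq0 => /forallP/(_ d).
  apply: subdiv_iso.
  pose f x : path_type l := Sub (inl x) isT.
  have fI : injective f by move=> x y /(congr1 val) [].
  have gP (v : path_type l) : exists x, f x == v.
    by case: v => -[x|[d t]] h; [exists x; rewrite -val_eqE | have := h; rewrite /= l0].
  exists f; split; last by move=> x y; rewrite /path_graph /= !l0 !andbT dart_adj.
  exists (fun v => xchoose (gP v)) => [x|v]; last exact/eqP/(xchooseP (gP v)).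
  exact/fI/eqP/(xchooseP (gP (f x))).
have [d0 ld0] : exists d, l d != 0.
  apply/existsP; apply: contra_eqT En; rewrite negb_exists => /forallP h.
  by rewrite big1 // => d _; apply/eqP; move: (h d); rewrite negbK.
pose l' d := if d == d0 then (l d0).-1 else l d.
have dd : dart d0 by apply: contraTT ld0 => /ld ->.
apply: (@subdiv_more _ _ _ _ (@path_graph l')); last first.
  apply: (path_graph_step dd); rewrite /l' ?eqxx; first by rewrite prednK // lt0n.
    by move=> d /negbTE->.
  by have := lL d0; lia.
apply: IH.
- have := En; rewrite (bigD1 d0) // [in X in _ -> X](bigD1 d0) //= {1}/l' eqxx => En'.
  rewrite (eq_bigr l); last by move=> d /negbTE h; rewrite /l' h.
  by lia.
- by move=> d; rewrite /l'; case: eqP => // _; have := lL d0; lia.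
- by move=> d; rewrite /l'; case: eqP => [->|_ /ld //]; rewrite dd.
Qed.
End Paths.

(** * The graph of pairwise crossing copies *)

Section Crossing.
Variables (H : sgraph) (M : nat).

(* Copy [i] of a subdivision of [H] has the vertices [inl (i, _)], private to it, and the
   vertices [inr (e, [set i; j])], which it shares with copy [j]. On the path of copy [i]
   replacing the edge [e] these alternate: [e.1], crossing with copy 0, [inr (e, 0)],
   crossing with copy 1, [inr (e, 1)], ..., crossing with copy [M], [e.2].
   Pairs [e] that are not edges of [H] and sets of more than two copies only give
   vertices outside all copies. *)
Definition crossing_vertex : finType :=
  ('I_M.+1 * (H + (H * H) * 'I_M) + (H * H) * {set 'I_M.+1})%type.

Definition link (e : H * H) (j : nat) (q : H + (H * H) * 'I_M) : bool :=
  match q with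
  | inl x => (x == e.1) && (j == 0) || (x == e.2) && (j == M)
  | inr (e', s) => (e' == e) && ((j == s) || (j == s.+1))
  end.

Definition incident i q (e : H * H) (A : {set 'I_M.+1}) : bool :=
  [exists j : 'I_M.+1, (A == [set i; j]) && link e j q].

Definition crossing_adj : rel crossing_vertex := fun v w =>
  match v, w with
  | inl (i, _), inl (i', _) => i != i'
  | inl (i, q), inr (e, A) | inr (e, A), inl (i, q) => incident i q e A
  | inr _, inr _ => false
  end.

Lemma crossing_adj_sym : symmetric crossing_adj.
Proof. by move=> [[i q]|[e A]] [[i' q']|[e' A']] //=; rewrite eq_sym. Qed.

Lemma crossing_adj_irr : irreflexive crossing_adj.
Proof. by move=> [[i q]|[e A]] //=; rewrite eqxx. Qed.

Definition crossing := SGraph crossing_adj_sym crossing_adj_irr.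

Lemma set2_injr (T : finType) (i : T) : injective (fun j => [set i; j]).
Proof.
move=> j j' /setP E; have := E j; have := E j'; rewrite !inE !eqxx !orbT.
case/orP=> /eqP // -> /esym; by rewrite orbb => /eqP.
Qed.

Lemma incident_set2 i q e j : incident i q e [set i; j] = link e j q.
Proof.
apply/existsP/idP => [[j' /andP[/eqP /set2_injr ->]]//|h].
by exists j; rewrite eqxx.
Qed.

(** A crossing has exactly two private neighbours in a given copy, so two distinct ones include the
    one at [s]. *)
Lemma link_both (e : H * H) (j : nat) q q' (s : 'I_M) :
  link e j q -> link e j q' -> q != q' -> (j == s) || (j == s.+1) ->
  (q == inr (e, s)) || (q' == inr (e, s)).
Proof.
have E e1 e2 (t t' : 'I_M) : (inr (e1, t) == inr (e2, t') :> H + (H * H) * 'I_M)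
    = (e1 == e2) && (t == t' :> nat).
  by rewrite -[LHS]/((e1, t) == (e2, t')) xpair_eqE val_eqE.
have sM := ltn_ord s.
case: q => [x|[e1 t1]]; case: q' => [y|[e2 t2]]; rewrite /= ?E.
- rewrite -[inl x == _]/(x == y).
  by case/orP=> /andP[/eqP-> j1] /orP[] /andP[/eqP-> j2]; rewrite ?eqxx //; lia.
- have := ltn_ord t2.
  by move=> ? /orP[] /andP[_ j1] /andP[-> j2] _; lia.
- have := ltn_ord t1.
  by move=> ? /andP[-> j2] /orP[] /andP[_ j1] _; lia.
by move=> /andP[/eqP-> h1] /andP[/eqP-> h2]; rewrite eqxx /=; lia.
Qed.

(* In copy [i], a set of minimum degree two cannot leave the path of an edge before its end. *)
Lemma core_full_path (Z : {set crossing}) i :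
  (forall i' q, inl (i', q) \in Z -> i' = i) ->
  (forall z, z \in Z -> exists x y, [/\ x \in Z, y \in Z, x != y, adj z x & adj z y]) ->
  (exists z, z \in Z) -> exists e, forall j, inr (e, [set i; j]) \in Z.
Proof.
move=> priv deg [z0 z0Z].
(* Private vertices of one copy are pairwise non-adjacent, so both neighbours in [Z] are
   crossings. *)
have shared q : inl (i, q) \in Z -> exists e j e' j',
    [/\ inr (e, [set i; j]) \in Z, inr (e', [set i; j']) \in Z,
        (e, j) != (e', j'), link e j q & link e' j' q].
  move=> qZ; have [x [y [xZ yZ xy ax ay]]] := deg _ qZ.
  case: x xZ ax xy => [[i1 q1] /priv-> /=|[e A] xZ /=]; first by rewrite eqxx.
  case: y yZ ay => [[i1 q1] /priv-> /=|[e' A'] yZ /=]; first by rewrite eqxx.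
  case/existsP=> j' /andP[/eqP EA' l']; case/existsP=> j /andP[/eqP EA l].
  rewrite {}EA' {}EA in xZ yZ * => n.
  exists e, j, e', j'; split=> //.
  by apply: contraNneq n => -[-> ->].
(* Crossings are independent, so both neighbours are private, hence in copy [i]. *)
have ends e A : inr (e, A) \in Z -> exists j q q',
    [/\ A = [set i; j], inl (i, q) \in Z, inl (i, q') \in Z, q != q' & link e j q && link e j q'].
  move=> uZ; have [x [y [xZ yZ xy ax ay]]] := deg _ uZ.
  case: x xZ ax xy => [[i1 q]|[? ?]] xZ //=; have ? := priv _ _ xZ; subst i1.
  case/existsP=> j /andP[/eqP EA l].
  case: y yZ ay => [[i2 q']|[? ?]] yZ //=; have ? := priv _ _ yZ; subst i2.
  rewrite EA incident_set2 => l' n.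
  exists j, q, q'; rewrite l l'; split=> //.
  by apply: contraNneq n => ->.
(* One crossing next to the private vertex at [s] forces that vertex into [Z], which in turn forces
   the crossing on its other side. *)
have inner e j (s : 'I_M) : inr (e, [set i; j]) \in Z -> (j == s :> nat) || (j == s.+1 :> nat) ->
    forall j' : 'I_M.+1, (j' == s :> nat) || (j' == s.+1 :> nat) -> inr (e, [set i; j']) \in Z.
  move=> /ends [j1 [q [q' [/set2_injr <- qZ q'Z qq' /andP[lq lq']]]]] js j' js'.
  have {qZ q'Z} sZ : inl (i, inr (e, s)) \in Z.
    by have /orP[] := link_both lq lq' qq' js; move/eqP=> E; rewrite -E.
  have [e1 [k1 [e2 [k2 [Z1 Z2 n12]]]]] := shared _ sZ.
  move=> /= /andP[/eqP E1 h1] /andP[/eqP E2 h2].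
  move: n12; rewrite -E1 -E2 xpair_eqE eqxx /= -val_eqE /= => n12.
  have : (j' == k1) || (j' == k2) by rewrite -!val_eqE /=; lia.
  by case/orP=> /eqP->; rewrite ?E1 // -E1 E2.
have [e [j0 eZ]] : exists e j, inr (e, [set i; j]) \in Z.
  case: z0 z0Z => [[i' q] h|[e A] h]; last first.
    by have [j [q [q' [E *]]]] := ends _ _ h; exists e, j; rewrite -E.
  have ? := priv _ _ h; subst i'; have [e [j [e' [j' [h' *]]]]] := shared _ h.
  by exists e, j.
exists e.
have up n (j : 'I_M.+1) : j = j0 + n :> nat -> inr (e, [set i; j]) \in Z.
  elim: n j => [|n IH] j Ej; first by rewrite (_ : j = j0) //; apply: val_inj => /=; lia.
  have jM := ltn_ord j.
  have sM : j0 + n < M by lia.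
  have jM' : j0 + n < M.+1 by lia.
  by apply: (inner e (Ordinal jM') (Ordinal sM)); rewrite /= ?IH //=; lia.
have down n (j : 'I_M.+1) : j0 = j + n :> nat -> inr (e, [set i; j]) \in Z.
  elim: n j => [|n IH] j Ej; first by rewrite (_ : j = j0) //; apply: val_inj => /=; lia.
  have jM := ltn_ord j0.
  have sM : j < M by lia.
  have jM' : j.+1 < M.+1 by lia.
  by apply: (inner e (Ordinal jM') (Ordinal sM)); rewrite /= ?IH //=; lia.
move=> j; case: (leqP j0 j) => h; first by apply: (up (j - j0)); lia.
by apply: (down (j0 - j)); lia.
Qed.

(** A private vertex of copy [i] sees every private vertex of the other copies; being anticomplete
    to the core, it confines it as [core_full_path] requires. *)
Lemma induced_subdiv_full_path (X : {set crossing}) :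
  has_core_and_edge (@adj H) -> induced_subdiv H X ->
  exists i e, forall j, inr (e, [set i; j]) \in X.
Proof.
move=> hH /core_and_edge_subdivision/(_ hH)[_ _ [Z [a [b [[[z0 Z0] Zd _ _ eab] anti]]]]].
pose Z' : {set crossing} := val @: Z.
have Z'X v : v \in Z' -> v \in X by case/imsetP=> z _ ->; apply: valP.
have [i [c anti_c]] : exists i c, forall z, z \in Z -> ~~ adj (inl (i, c) : crossing) (val z).
  move: eab anti; rewrite /induced_rel; case: (val a) => [[i c] _ anti|[e A]].
    by exists i, c => z /anti /andP[].
  case: (val b) => [[i c] _ anti|[e' A'] //].
  by exists i, c => z /anti /andP[].
have [|||e he] := @core_full_path Z' i; last by exists i, e => j; apply/Z'X/he.
- move=> i' q /imsetP[z zZ E]; move: (anti_c z zZ); rewrite -E /= negbK.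
  by move/eqP.
- move=> _ /imsetP[z zZ ->]; have [x [y [xZ yZ xy ax ay]]] := Zd z zZ.
  by exists (val x), (val y); split=> //; exact: imset_f.
- by exists (val z0); exact: imset_f.
Qed.

(** * The copies are induced subdivisions that few vertices cannot hit *)

(** There are [M.+1] crossings, alternating with [M] private vertices. *)
Definition copy_length (d : H * H) : nat := if dart d then M.*2.+1 else 0.

(* The option is never [None] when [t] is odd. *)
Definition copy_vertex (i : 'I_M.+1) (v : H + (H * H) * 'I_M.*2.+1) : crossing :=
  match v with
  | inl x => inl (i, inl x)
  | inr (d, t) =>
      if odd t then
        if insub t./2 is Some s then inl (i, inr (d, s)) else inl (i, inl d.1)
      else inr (d, [set i; inord t./2])
  end.

Variant copy_vertex_spec i (d : H * H) (t : nat) : crossing -> Type :=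
  | CopyPrivate (s : 'I_M) of t = s.*2.+1 : copy_vertex_spec i d t (inl (i, inr (d, s)))
  | CopyShared (j : 'I_M.+1) of t = j.*2 : copy_vertex_spec i d t (inr (d, [set i; j])).

Lemma copy_vertexP i d (t : 'I_M.*2.+1) :
  copy_vertex_spec i d t (copy_vertex i (inr (d, t))).
Proof.
have tM := ltn_ord t; rewrite /=; case: ifP => ot.
  case: insubP => [s _ Es|]; last by lia.
  by apply: CopyPrivate; rewrite Es; lia.
by apply: CopyShared; rewrite inordK; lia.
Qed.

Lemma copy_vertex_inj i : injective (copy_vertex i).
Proof.
move=> [x|[d t]] [y|[d' t']].
- by case=> ->.
- by case: copy_vertexP.
- by case: copy_vertexP.
case: copy_vertexP => s Es; case: copy_vertexP => s' Es' // [].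
  by move=> -> ss; rewrite (_ : t = t') //; apply: val_inj; rewrite /= Es Es' ss.
by move=> -> /set2_injr ss; rewrite (_ : t = t') //; apply: val_inj; rewrite /= Es Es' ss.
Qed.

Definition copy (i : 'I_M.+1) : {set crossing} :=
  (fun v : path_type M.*2.+1 copy_length => copy_vertex i (val v)) @: path_type M.*2.+1 copy_length.

Lemma copy_subdiv i : induced_subdiv H (copy i).
Proof.
have := @path_graph_subdivision H M.*2.+1 copy_length.
rewrite /copy_length => S; apply: (subdivision_giso (S _ _)) => {S}.
- by move=> d; case: ifP.
- by move=> d /negbTE->.
apply: giso_induced => [v w /copy_vertex_inj|]; first exact: val_inj.
move=> [v hv] [w hw]; rewrite /path_graph /=.
case: v hv => [x|[d t]]; case: w hw => [y|[d' t']] hw hv.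
- rewrite /= eqxx; do 2 case: ifP => ? //=; by rewrite ?andbF.
- case: copy_vertexP => s Es; move: hw; rewrite /= ?eqxx ?incident_set2 /= Es; case: ifP => // _ _.
    by have := ltn_ord s; case: (x == _); case: (x == _) => //=; lia.
  by case: (x == _); case: (x == _) => //=; lia.
- case: copy_vertexP => s Es; move: hv; rewrite /= ?eqxx ?incident_set2 /= Es; case: ifP => // _ _.
    by have := ltn_ord s; case: (y == _); case: (y == _) => //=; lia.
  by case: (y == _); case: (y == _) => //=; lia.
- rewrite /path_rel.
  case: copy_vertexP => s Es; case: copy_vertexP => s' Es' /=;
    rewrite ?eqxx ?incident_set2 /= ?Es ?Es' 1?[d' == d]eq_sym; case: (d == d') => //=; lia.
Qed.

(** A crossing [inr (e, A)] lies only on copies indexed by [A], and on none when [A] has more than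
    two elements. *)
Lemma card_copies_through (y : crossing) : #|[set i | y \in copy i]| <= 2.
Proof.
have mem i : y \in copy i -> match y with
    inl (i', _) => i = i' | inr (_, A) => i \in A /\ #|A| <= 2 end.
  case/imsetP=> -[[x|[d t]] h] _ ->; first by [].
  rewrite [val _]/=; case: copy_vertexP => // j _.
  by rewrite !inE eqxx cards2; case: (_ != _).
case: y mem => [[i q]|[e A]] mem.
  apply: (@leq_trans #|[set i]|); last by rewrite cards1.
  by apply/subset_leq_card/subsetP=> i'; rewrite !inE => /mem ->.
have [A2|A2] := leqP #|A| 2.
  by apply: leq_trans A2; apply/subset_leq_card/subsetP=> i; rewrite inE => /mem[].
rewrite (_ : [set _ | _] = set0) ?cards0 //; apply/setP=> i; rewrite !inE.
by apply/negP=> /mem[_]; rewrite leqNgt A2.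
Qed.

(** Each vertex of [Y] spoils at most two of the [M.+1] copies. *)
Lemma exists_copy_avoiding (Y : {set crossing}) : #|Y|.*2 <= M ->
  exists i, [disjoint Y & copy i].
Proof.
move=> YM; pose B := \bigcup_(y in Y) [set i | y \in copy i].
have BM : #|B| < M.+1.
  rewrite ltnS; apply: leq_trans YM; rewrite -muln2 -sum_nat_const.
  rewrite /B; elim/big_ind2: _ => [|n A m A' hA hA'|y _]; first by rewrite cards0.
    by rewrite (leq_trans (leq_card_setU A A')) ?leq_add.
  exact: card_copies_through.
have [i iB] : exists i, i \notin B.
  apply/existsP; apply: contraLR BM; rewrite negb_exists => /forallP h.
  rewrite -leqNgt -[X in X <= _](card_ord M.+1) -cardsT subset_leq_card //.
  by apply/subsetP=> i _; move: (h i); rewrite negbK.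
exists i; rewrite disjoint_subset; apply/subsetP=> y yY; rewrite inE.
by apply: contra iB => yi; apply/bigcupP; exists y; rewrite ?inE.
Qed.

End Crossing.

Theorem mainTheorem5 (H : sgraph) (c : seq H) (a b : H) :
  is_cycle c -> adj a b ->
  (forall v, v \in c -> ~~ adj a v && ~~ adj b v) ->
  ~ induced_EP H.
Proof.
move=> hc hab anti [f EP].
have hH := core_and_edge_cycle hc hab anti.
(* [k] exceeds the number of pairs [e], for the pigeonhole; [M] is twice the size allowed for a
   hitting set. *)
pose k := #|{: H * H}|.+1; pose M := (f k).*2.
have [//|[Xs [sub dis]]|[Y [YM hit]]] := EP (crossing H M) k; last first.
  have [|i di] := @exists_copy_avoiding H M Y; first by rewrite leq_double.
  by have := hit _ (copy_subdiv H i); rewrite di.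
have [i hi] := fin_all_exists (fun m => induced_subdiv_full_path hH (sub m)).
have [e he] := fin_all_exists hi.
have /injectivePn[m [m' mm' E]] : ~~ injectiveb e.
  by apply/negP=> /injectiveP /leq_card; rewrite card_ord ltnn.
(* The common vertex is the crossing of copies [i m] and [i m'] on the path of [e m = e m']; this
   also covers [i m = i m']. *)
have := dis _ _ mm'; rewrite disjoint_subset => /subsetP/(_ _ (he m (i m'))).
by rewrite inE setUC E he.
Qed.
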